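(* Let $\alpha$ be a composition of a non-negative integer $n$. Then \[\zeta_-(F_\alpha)=\frac{(-1)^{p_-(\alpha)}}{2^{2\lfloor n/2\rfloor}}\,C\bigl(p_-(\alpha),\lfloor n/2\rfloor-p_-(\alpha)\bigr),\] \[\zeta_+(F_\alpha)=\begin{cases}\dfrac{(-1)^{p_+(\alpha)}}{2^n}\,C\bigl(p_+(\alpha),n/2-p_+(\alpha)\bigr)&\text{if } n\text{ is even},\\ 0&\text{if } n\text{ is odd.}\end{cases}\]
   Context: $\Bbbk$ is a field of characteristic $\neq 2$. A composition $\alpha=(a_1,\ldots,a_k)$ of $n\ge0$ is a sequence of positive integers with sum $n$; $k(\alpha)=k$; $()$ is the empty composition. For compositions $\alpha,\beta$ of $n$, $\beta\ge\alpha$ means $\beta$ refines $\alpha$ ($\beta$ is obtained from $\alpha$ by splitting parts). Statistics: $p_-(\alpha)=\#\{i\ne k: a_i>1\}$; $p_+(\alpha)=1+\#\{i\ne 1,k: a_i>1\}$ if $k>1$, and $p_+(\alpha)=0$ if $k\le 1$. ${\mathcal{Q}Sym}$ is the Hopf algebra of quasi-symmetric functions over $\Bbbk$, graded and connected, with monomial basis $M_\alpha=\sum_{i_1<\cdots<i_k}x_{i_1}^{a_1}\cdots x_{i_k}^{a_k}$ ($M_{()}=1$), fundamental basis $F_\alpha=\sum_{\beta\ge\alpha}M_\beta$, ordinary product, coproduct $\Delta(M_\alpha)=\sum_{i=0}^kM_{(a_1,\ldots,a_i)}\otimes M_{(a_{i+1},\ldots,a_k)}$, counit $\epsilon(M_\alpha)=\delta_{\alpha,()}$.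 Convolution of functionals: $\rho\psi=m\circ(\rho\otimes\psi)\circ\Delta$. Characters (algebra morphisms ${\mathcal{Q}Sym}\to\Bbbk$) form a group under convolution. For a functional $\varphi$, $\bar\varphi(h)=(-1)^n\varphi(h)$ for $h$ homogeneous of degree $n$; $\varphi$ is even if $\bar\varphi=\varphi$ and odd if $\bar\varphi=\varphi^{-1}$. Every character factors uniquely as $\varphi=\varphi_+\varphi_-$ with $\varphi_+$ even and $\varphi_-$ odd characters. The universal character is $\zeta(f)=f(1,0,0,\ldots)$, so $\zeta(M_\alpha)=\zeta(F_\alpha)=1$ if $\alpha=()$ or $\alpha=(n)$ and $0$ otherwise; $\zeta_\pm$ are its even and odd parts. $C(m,n)=\frac{(2m)!(2n)!}{m!(m+n)!n!}$. *)

(* Defs.v *)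
(* QSym is modelled through its monomial basis: a linear
   functional on QSym is determined by its values on the M_alpha, so we
   represent it as a function  phi : seq nat -> K  with phi alpha = phi(M_alpha)
   (values on sequences that are not compositions are irrelevant). *)
From HB Require Import structures.
From mathcomp Require Import all_boot all_order all_algebra.
Set Implicit Arguments. Unset Strict Implicit. Unset Printing Implicit Defensive.
Import Order.TTheory GRing.Theory Num.Theory.
Local Open Scope ring_scope.

Definition is_comp (a : seq nat) : bool := all (fun x => 0 < x)%N a.

(* compositions of n.+1 *)
Fixpoint comps_pos (n : nat) : seq (seq nat) :=
  match n with
  | 0 => [:: [:: 1%N]]
  | n'.+1 => [seq 1%N :: c | c <- comps_pos n'] ++
             [seq (head 0%N c).+1 :: behead c | c <- comps_pos n']
  end.

Definition comps (n : nat) : seq (seq nat) :=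
  if n is n'.+1 then comps_pos n' else [:: [::]].

Fixpoint refinements (a : seq nat) : seq (seq nat) :=
  match a with
  | [::] => [:: [::]]
  | x :: a' => [seq c ++ d | c <- comps x, d <- refinements a']
  end.

(* quasi-shuffle (stuffle): M_a * M_b = sum_{g <- qsh a b} M_g *)
Fixpoint qsh (a : seq nat) : seq nat -> seq (seq nat) :=
  match a with
  | [::] => fun b => [:: b]
  | x :: a' =>
    fix qsh_a (b : seq nat) : seq (seq nat) :=
      match b with
      | [::] => [:: x :: a']
      | y :: b' => [seq x :: g | g <- qsh a' (y :: b')] ++
                   [seq y :: g | g <- qsh_a b'] ++
                   [seq (x + y)%N :: g | g <- qsh a' b']
      end
  end.

Section QSym.
Variable K : fieldType.

Definition functional := seq nat -> K.

(* convolution  rho psi = m o (rho (x) psi) o Delta  on M_alpha *)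
Definition conv (rho psi : functional) : functional :=
  fun a => \sum_(i < (size a).+1) rho (take i a) * psi (drop i a).

Definition counit : functional := fun a => (a == [::])%:R.

Definition fbar (phi : functional) : functional :=
  fun a => (-1) ^+ (sumn a) * phi a.

Definition is_character (phi : functional) : Prop :=
  phi [::] = 1 /\
  forall a b, is_comp a -> is_comp b ->
    phi a * phi b = \sum_(g <- qsh a b) phi g.

Definition is_even (phi : functional) : Prop :=
  forall a, is_comp a -> fbar phi a = phi a.

Definition is_odd (phi : functional) : Prop :=
  forall a, is_comp a ->
    conv (fbar phi) phi a = counit a /\ conv phi (fbar phi) a = counit a.

(* value on the fundamental basis: F_alpha = sum_{beta >= alpha} M_beta *)
Definition onF (phi : functional) (a : seq nat) : K :=
  \sum_(b <- refinements a) phi b.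

Definition zeta : functional := fun a => (size a <= 1)%N%:R.

End QSym.

Definition p_minus (a : seq nat) : nat :=
  count (fun x => 1 < x)%N (take (size a).-1 a).

Definition p_plus (a : seq nat) : nat :=
  if (1 < size a)%N then (1 + count (fun x => 1 < x)%N (drop 1 (take (size a).-1 a)))%N
  else 0%N.

(* C(m,n) = (2m)!(2n)!/(m!(m+n)!n!)  (an integer: super Catalan number) *)
Definition superC (m n : nat) : nat :=
  ((2 * m)`! * (2 * n)`!) %/ (m`! * (m + n)`! * n`!).

(* Main.v *)
(* A functional on QSym is a noncommutative series in the duals X_a of the
   M_(a).  Let O and E be the sums of the X_a with a odd, resp. even (a > 0),
   so that zeta = 1 + E + O, and let U = (1 + E)^-1 O.  Replacing each X_a by
   (-1)^a X_a negates U, and zeta = (1 + E)(1 + U); hence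
     zeta_- = ((1 + U) / (1 - U))^(1/2)  and  zeta_+ = (1 + E)(1 - U^2)^(1/2).
   These are indeed the two parts, by uniqueness of the factorisation, which
   only uses evenness, oddness and the value 1 at the empty composition.

   On the fundamental basis, summing (1 - tU)^-1 over the refinements of alpha
   is a product over the parts of alpha: a nonfinal part x contributes t if
   x = 1 and t^x - t^(x-2) otherwise, and the final part x contributes t^x.
   The total is t^n (1 - t^-2)^(p_-).  Replacing t^j by the coefficient of U^j
   in zeta_- turns it into an iterated difference of the normalised central
   binomials, evaluated by 4 C(p,q) = C(p+1,q) + C(p,q+1). *)
Require Import Defs.
From HB Require Import structures.
From mathcomp Require Import all_boot all_order all_algebra.
From mathcomp Require Import zify ring.
Set Implicit Arguments. Unset Strict Implicit. Unset Printing Implicit Defensive.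
Import Order.TTheory GRing.Theory Num.Theory.
Local Open Scope ring_scope.

(** * Super Catalan numbers: integrality and recurrences *)

Definition superC_den (m n : nat) : nat := (m`! * (m + n)`! * n`!)%N.
Definition superC_num (m n : nat) : nat := ((2 * m)`! * (2 * n)`!)%N.

Lemma superC_den_gt0 m n : (0 < superC_den m n)%N.
Proof. by rewrite !muln_gt0 !fact_gt0. Qed.

Lemma superC_denSl m n :
  superC_den m.+1 n = (m.+1 * (m + n).+1 * superC_den m n)%N.
Proof. by rewrite /superC_den addSn !factS; ring. Qed.

Lemma superC_denSr m n :
  superC_den m n.+1 = (n.+1 * (m + n).+1 * superC_den m n)%N.
Proof. by rewrite /superC_den addnS !factS; ring. Qed.

Lemma superC_numSl m n :
  superC_num m.+1 n = (m.+1 * (4 * m + 2) * superC_num m n)%N.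
Proof. by rewrite /superC_num mulnS !add2n !factS; ring. Qed.

Lemma superC_numSr m n :
  superC_num m n.+1 = (n.+1 * (4 * n + 2) * superC_num m n)%N.
Proof. by rewrite /superC_num mulnS !add2n !factS; ring. Qed.

(** Integrality, needed since [superC] is a truncated quotient. After clearing factors, 4m+2 =
    4(m+n+1) - (4n+2) reduces m+1 to m at n and n+1; m = 0 is a central binomial coefficient. *)
Lemma superC_den_dvd m n : (superC_den m n %| superC_num m n)%N.
Proof.
elim: m n => [|m IH] n.
  rewrite /superC_den /superC_num muln0 mul1n add0n fact0 mul1n.
  have le_n : (n <= 2 * n)%N by lia.
  rewrite -(bin_fact le_n) (_ : 2 * n - n = n)%N; last by lia.
  exact: dvdn_mull.
have IHS := IH n.+1; rewrite superC_denSr superC_numSr -!mulnA in IHS.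
rewrite dvdn_pmul2l // in IHS.
rewrite superC_denSl superC_numSl -!mulnA dvdn_pmul2l //.
have -> : ((4 * m + 2) * superC_num m n =
    4 * ((m + n).+1 * superC_num m n) - (4 * n + 2) * superC_num m n)%N.
  by rewrite mulnA -mulnBl; congr muln; lia.
by rewrite dvdn_sub // dvdn_mull // dvdn_pmul2l.
Qed.

Lemma superC_mul_den m n : (superC m n * superC_den m n = superC_num m n)%N.
Proof. exact: divnK (superC_den_dvd m n). Qed.

Lemma superC_Sl m n : ((m + n).+1 * superC m.+1 n = (4 * m + 2) * superC m n)%N.
Proof.
apply/eqP; rewrite -(eqn_pmul2l (isT : 0 < m.+1)%N).
rewrite -(eqn_pmul2r (superC_den_gt0 m n)); apply/eqP.
transitivity (superC m.+1 n * superC_den m.+1 n)%N.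
  by rewrite superC_denSl; ring.
by rewrite superC_mul_den superC_numSl -superC_mul_den; ring.
Qed.

Lemma superC_Sr m n : ((m + n).+1 * superC m n.+1 = (4 * n + 2) * superC m n)%N.
Proof.
apply/eqP; rewrite -(eqn_pmul2l (isT : 0 < n.+1)%N).
rewrite -(eqn_pmul2r (superC_den_gt0 m n)); apply/eqP.
transitivity (superC m n.+1 * superC_den m n.+1)%N.
  by rewrite superC_denSr; ring.
by rewrite superC_mul_den superC_numSr -superC_mul_den; ring.
Qed.

Lemma superC_rec m n : (superC m.+1 n + superC m n.+1 = 4 * superC m n)%N.
Proof.
apply/eqP; rewrite -(eqn_pmul2l (isT : 0 < (m + n).+1)%N) mulnDr.
by rewrite superC_Sl superC_Sr; apply/eqP; ring.
Qed.

Lemma superC00 : superC 0 0 = 1%N.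
Proof. by []. Qed.

(* Symmetrising, [2 * sum j s_j s_(m-j) = m * sum s_j s_(m-j)]; combined with
   [superC_Sr] this quadruples the sum when [m] grows by one. *)
Lemma sum_superC0_mul m :
  (\sum_(j < m.+1) superC 0 j * superC 0 (m - j) = 4 ^ m)%N.
Proof.
set s := superC 0.
pose S k := (\sum_(j < k.+1) s j * s (k - j))%N.
pose W k := (\sum_(j < k.+1) j * (s j * s (k - j)))%N.
have W2 k : (2 * W k = k * S k)%N.
  rewrite mul2n -addnn {1}/W (reindex_inj rev_ord_inj) /= -big_split /=.
  rewrite /S big_distrr; apply: eq_bigr => j _ /=.
  have le_jk : (j <= k)%N by rewrite -ltnS.
  rewrite subSS subKn // (mulnC (s (k - j)%N)) -mulnDl.
  by rewrite subnK.
rewrite -/(S m); elim: m => [|m IH]; first by rewrite /S big_ord1.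
apply/eqP; rewrite -(eqn_pmul2l (isT : 0 < m.+1)%N) -W2 expnS -IH.
have -> : W m.+1 = (4 * W m + 2 * S m)%N.
  rewrite /W big_ord_recl mul0n add0n !big_distrr -big_split /=.
  apply: eq_bigr => j _; rewrite /bump /= add1n subSS mulnA.
  by have := superC_Sr 0 j; rewrite add0n -/s => ->; ring.
by apply/eqP; have := W2 m; lia.
Qed.

(** * Convolution of power series in [U] *)

Section Functionals.
Variable K : fieldType.
Implicit Types (c d e : nat -> K) (rho psi : functional K).

Definition cauchy c d (m : nat) : K := \sum_(i < m.+1) c i * d (m - i)%N.

Definition delay c (j : nat) : K := if j is j'.+1 then c j' else 0.

(** Under t^j -> c_j, multiplication by 1 - t^2. *)
Definition diff2 c (j : nat) : K := c j - c j.+2.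

(* In the algebra dual to QSym, with [O] and [E] the sums of the duals of the
   M_(a), [a] odd, resp. even, [phi c] is the series [sum_j c_j U^j] where
   [U = (1 + E)^-1 O]. *)
Fixpoint phi c (a : seq nat) : K :=
  if a is x :: a' then
    if odd x then phi (fun j => c j.+1) a' else counit K a' * c 0%N - phi c a'
  else c 0%N.

(** Linearity in the coefficients, with a pointwise hypothesis so that it also yields
    extensionality, scaling ([v = 0]) and vanishing ([u = v = 0]). *)
Lemma phi_comb u v c d e a : (forall j, e j = u * c j + v * d j) ->
  phi e a = u * phi c a + v * phi d a.
Proof.
elim: a c d e => [|x a IH] c d e eE //=.
case: ifP => _; first by apply: IH => j; rewrite eE.
by rewrite (IH c d) // eE; ring.
Qed.

Lemma eq_phi c d a : c =1 d -> phi c a = phi d a.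
Proof.
move=> cd; rewrite (@phi_comb 1 0 d d c) => [|j]; last by rewrite cd; ring.
by ring.
Qed.

Lemma phi_delta a : phi (fun j => (j == 0%N)%:R) a = counit K a.
Proof.
elim: a => [|x a IH] //=; case: ifP => _.
  rewrite (@phi_comb 0 0 (fun=> 0) (fun=> 0)) => [|j /=]; last by ring.
  by rewrite /counit /=; ring.
by rewrite IH /= mulr1 subrr.
Qed.

Lemma fbar_phi c a : fbar (phi c) a = phi (fun j => (-1) ^+ j * c j) a.
Proof.
rewrite /fbar; elim: a c => [|x a IH] c /=; first by [].
rewrite exprD -(signr_odd K x); case: ifP => _.
  rewrite expr1 -mulrA IH.
  rewrite [RHS](@phi_comb (-1) 0 (fun j => (-1) ^+ j * c j.+1) (fun=> 0)).
    by ring.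
  by move=> j /=; rewrite exprS; ring.
rewrite expr0 !mul1r mulrBr IH; congr (_ - _).
by rewrite /counit; case: a {IH} => [|y a] /=; rewrite ?mul1r // !mul0r mulr0.
Qed.

Lemma conv_cons rho psi x a :
  conv rho psi (x :: a) =
    rho [::] * psi (x :: a) + conv (fun b => rho (x :: b)) psi a.
Proof. by rewrite /conv big_ord_recl. Qed.

Lemma eq_convl rho rho' psi a :
  rho =1 rho' -> conv rho psi a = conv rho' psi a.
Proof. by move=> eq_rho; apply: eq_bigr => i _; rewrite eq_rho. Qed.

Lemma is_comp_take_drop i a : is_comp a -> is_comp (take i a) /\ is_comp (drop i a).
Proof. by move=> ha; apply/andP; rewrite -all_cat cat_take_drop. Qed.

Lemma conv_counitl psi a : conv (counit K) psi a = psi a.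
Proof.
case: a => [|x a]; first by rewrite /conv big_ord1 /counit /= mul1r.
rewrite conv_cons /counit /= mul1r /conv big1 ?addr0 // => i _.
by rewrite mul0r.
Qed.

Lemma conv_counitB u rho psi a :
  conv (fun b => counit K b * u - rho b) psi a =
    u * psi a - conv rho psi a.
Proof.
rewrite -(conv_counitl psi a) /conv big_distrr -sumrB /=.
by apply: eq_bigr => i _; ring.
Qed.

Lemma cauchyS c d m :
  cauchy c d m.+1 = c 0%N * d m.+1 + cauchy (fun j => c j.+1) d m.
Proof. by rewrite /cauchy big_ord_recl subn0. Qed.

(** Series in [U] multiply as power series. If f = c_0 + U g, then U = O - E U gives f = c_0 + O g +
    E (c_0 - f), the recursion of [phi] on the first letter, which the induction follows. *)
Lemma conv_phi c d a : conv (phi c) (phi d) a = phi (cauchy c d) a.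
Proof.
elim: a c => [|x a IH] c; first by rewrite /conv /= /cauchy !big_ord1.
rewrite conv_cons /=; case: ifP => _.
  rewrite IH [RHS](@phi_comb (c 0%N) 1 (fun j => d j.+1)
    (cauchy (fun j => c j.+1) d)) ?mul1r // => j.
  by rewrite cauchyS mul1r.
rewrite conv_counitB IH.
by rewrite [cauchy c d 0%N]/cauchy big_ord1; ring.
Qed.

Lemma cauchyBl c c' d m :
  cauchy (fun j => c j - c' j) d m = cauchy c d m - cauchy c' d m.
Proof. by rewrite /cauchy -sumrB; apply: eq_bigr => i _; rewrite mulrBl. Qed.

Lemma cauchy_delay c d m : cauchy (delay c) d m = delay (cauchy c d) m.
Proof.
case: m => [|m]; first by rewrite /cauchy big_ord1 mul0r.
by rewrite cauchyS mul0r add0r.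
Qed.

Lemma sum_even_half (F : nat -> K) m :
  \sum_(i < m.+1) (if odd i then 0 else F i./2) = \sum_(j < (m./2).+1) F j.
Proof.
elim: m => [|m IH]; first by rewrite !big_ord1.
rewrite big_ord_recr IH /=.
case: (boolP (odd m)) => om /=; last by rewrite uphalf_half (negbTE om) addr0.
by rewrite uphalf_half om add1n [RHS]big_ord_recr.
Qed.

(** * Uniqueness of the even-odd factorisation *)

Lemma conv_ends rho psi x a : rho [::] = 1 -> psi [::] = 1 ->
  conv rho psi (x :: a) = psi (x :: a) + rho (x :: a)
    + \sum_(i < size a) rho (take i.+1 (x :: a)) * psi (drop i.+1 (x :: a)).
Proof.
move=> r1 p1; rewrite /conv big_ord_recl big_ord_recr /= r1 mul1r.
by rewrite take_size drop_size p1 mulr1; ring.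
Qed.

(** Induction on length: shorter pieces agree, so the sum of the two values at [a] is determined. In
    odd degree evenness kills [rho]; in even degree the oddness equation determines twice
    [psi a]. *)
Lemma even_odd_factor_uniq (rho psi rho' psi' : functional K) :
    2%:R != 0 :> K ->
    rho [::] = 1 -> psi [::] = 1 -> rho' [::] = 1 -> psi' [::] = 1 ->
    is_even rho -> is_even rho' ->
    (forall a, is_comp a -> conv (fbar psi) psi a = counit K a) ->
    (forall a, is_comp a -> conv (fbar psi') psi' a = counit K a) ->
    (forall a, is_comp a -> conv rho psi a = conv rho' psi' a) ->
  forall a, is_comp a -> rho a = rho' a /\ psi a = psi' a.
Proof.
move=> char2 r1 p1 r1' p1' re re' po po' fac a.
have half0 (u : K) : u + u = 0 -> u = 0.
  move=> /eqP; rewrite -mulr2n -mulr_natl mulf_eq0 (negbTE char2) /=.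
  by move/eqP.
have [k] := ubnP (size a); elim: k a => // k IH [_ _|x a].
  by rewrite r1 p1 r1' p1'.
rewrite ltnS => sz ha; rewrite /= in sz.
have IHt i : (i < size a)%N ->
    let t := take i.+1 (x :: a) in rho t = rho' t /\ psi t = psi' t.
  move=> lt_i; apply: IH.
    by rewrite size_take_min; apply: leq_trans sz; rewrite ltnS geq_min lt_i.
  exact: (is_comp_take_drop i.+1 ha).1.
have IHd i : (i < size a)%N ->
    let t := drop i.+1 (x :: a) in rho t = rho' t /\ psi t = psi' t.
  move=> lt_i; apply: IH.
    by rewrite size_drop /= subSS; apply: leq_ltn_trans sz; apply: leq_subr.
  exact: (is_comp_take_drop i.+1 ha).2.
have fac_a := fac _ ha; rewrite !conv_ends // in fac_a.
have sum_eq : psi (x :: a) + rho (x :: a) = psi' (x :: a) + rho' (x :: a).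
  move: fac_a; rewrite (eq_bigr (fun i : 'I_(size a) =>
    rho' (take i.+1 (x :: a)) * psi' (drop i.+1 (x :: a)))); last first.
    by move=> i _; rewrite (IHt i _).1 // (IHd i _).2.
  exact: addIr.
case: (boolP (odd (sumn (x :: a)))) => par.
  have z (f : functional K) : is_even f -> f (x :: a) = 0.
    move=> /(_ _ ha); rewrite /fbar -signr_odd par expr1 mulN1r => fE.
    by apply: half0; rewrite -{1}fE addNr.
  by move: sum_eq; rewrite (z _ re) (z _ re') !addr0.
have b1 f : f [::] = 1 -> fbar f [::] = 1 :> K.
  by rewrite /fbar => ->; rewrite mulr1.
have odd_a : psi (x :: a) = psi' (x :: a).
  have := po _ ha; rewrite -(po' _ ha) !conv_ends ?b1 //.
  rewrite /fbar -!(signr_odd K (sumn (x :: a))) (negbTE par) !mul1r.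
  rewrite (eq_bigr (fun i : 'I_(size a) =>
    fbar psi' (take i.+1 (x :: a)) * psi' (drop i.+1 (x :: a)))); last first.
    by move=> i _; rewrite /fbar (IHt i _).2 // (IHd i _).2.
  move/addIr => E; apply/eqP; rewrite -subr_eq0; apply/eqP; apply: half0.
  by rewrite addrACA -opprD E subrr.
by split=> //; move: sum_eq; rewrite odd_a => /addrI.
Qed.

(** * Values of [phi c] on the fundamental basis *)

Lemma onF_cons rho x a :
  onF rho (x :: a) =
    \sum_(b <- refinements a) \sum_(g <- comps x) rho (g ++ b).
Proof. by rewrite /onF /= big_allpairs_dep exchange_big. Qed.

Lemma comps_pos_nilF n : {in comps_pos n, forall g, g != [::]}.
Proof.
elim: n => [|n IH] g /=; first by rewrite inE => /eqP->.
by rewrite mem_cat => /orP[] /mapP[h _ ->].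
Qed.

Lemma sum_comps_posS rho n b :
  \sum_(g <- comps_pos n.+1) rho (g ++ b) =
    \sum_(g <- comps_pos n) rho (1%N :: g ++ b) +
    \sum_(g <- comps_pos n) rho ((head 0%N g).+1 :: behead g ++ b).
Proof. by rewrite /= big_cat !big_map. Qed.

Lemma sum_comps_posS_succ rho n b :
  \sum_(g <- comps_pos n.+1) rho ((head 0%N g).+1 :: behead g ++ b) =
    \sum_(g <- comps_pos n) rho (2%N :: g ++ b) +
    \sum_(g <- comps_pos n) rho ((head 0%N g).+2 :: behead g ++ b).
Proof. by rewrite /= big_cat !big_map. Qed.

(* The compositions of [n.+3] with first part at least [2] are, for [g] a
   composition of [n.+1], [2 :: g] and [g] with its first part increased by [2];
   these two get opposite values. *)
Lemma phi_succ_cancel c n b :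
  \sum_(g <- comps_pos n.+1) phi c ((head 0%N g).+1 :: behead g ++ b) = 0.
Proof.
rewrite sum_comps_posS_succ -big_split big_seq big1 //= => g /comps_pos_nilF.
case: g => [|y g] //= _; rewrite negbK.
by case: ifP => _; rewrite /counit /=; ring.
Qed.

(** Only compositions starting with 1 survive [phi_succ_cancel], and that 1 shifts [c]; the base
    case is (1,1) and (2). When nothing follows, the counit term leaves t^(n+2) alone. *)
Lemma sum_comps_pos_phi c n b :
  \sum_(g <- comps_pos n.+1) phi c (g ++ b) =
    phi (fun j => c (j + n.+2)%N) b - phi (fun j => c (j + n)%N) b
      + counit K b * c n.
Proof.
elim: n c => [|n IH] c.
  rewrite sum_comps_posS /= !big_seq1 /=.
  rewrite (@eq_phi (fun j => c (j + 2)%N) (fun j => c j.+2)); last first.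
    by move=> j; rewrite addn2.
  by rewrite (@eq_phi (fun j => c (j + 0)%N) c) => [|j]; rewrite ?addn0 //; ring.
rewrite sum_comps_posS phi_succ_cancel addr0 (IH (fun j => c j.+1)).
by do 2![congr (_ + _)]; rewrite ?(congr1 -%R) //; [|congr (- _)];
  apply: eq_phi => j; rewrite !addnS.
Qed.

Lemma onF_phi1 c x : (0 < x)%N -> onF (phi c) [:: x] = c x.
Proof.
case: x => // x _; rewrite onF_cons big_seq1.
case: x => [|x]; first by rewrite big_seq1.
by rewrite sum_comps_pos_phi /= /counit /= add0n mul1r; ring.
Qed.

Lemma is_comp_comps n : {in comps n, forall g, is_comp g}.
Proof.
case: n => [|n] g /=; first by rewrite inE => /eqP->.
elim: n g => [|n IH] g /=; first by rewrite inE => /eqP->.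
rewrite mem_cat => /orP[] /mapP[h /IH hc ->] //=.
by case: h hc => //= x h /andP[].
Qed.

Lemma is_comp_refinements a : {in refinements a, forall b, is_comp b}.
Proof.
elim: a => [|x a IH] b /=; first by rewrite inE => /eqP->.
case/allpairsP=> -[g h] [/= /is_comp_comps gc /IH hc ->].
by rewrite /is_comp all_cat; apply/andP.
Qed.

Lemma refinements_nilF x a : (0 < x)%N ->
  {in refinements (x :: a), forall b, b != [::]}.
Proof.
case: x => // x _ b /allpairsP[[g h] [/= /comps_pos_nilF]].
by case: g => // y g _ _ ->.
Qed.

Lemma onF_phi_one c a : onF (phi c) (1%N :: a) = onF (phi (fun j => c j.+1)) a.
Proof.
by rewrite onF_cons; apply: eq_bigr => b _; rewrite big_seq1.
Qed.

(** A nonempty tail kills the counit term, and t^(x+2) - t^x = -(1 - t^2) t^x. *)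
Lemma onF_phi_cons c x y a : (0 < y)%N ->
  onF (phi c) (x.+2 :: y :: a) =
    - onF (phi (diff2 (fun j => c (j + x)%N))) (y :: a).
Proof.
move=> y0; rewrite onF_cons -sumrN !big_seq; apply: eq_bigr => b dI.
rewrite sum_comps_pos_phi.
have /negbTE dN := refinements_nilF y0 dI.
rewrite [in RHS](@phi_comb 1 (-1) (fun j => c (j + x)%N)
  (fun j => c (j + x.+2)%N)) => [|j]; last by rewrite /diff2 !addnS !addSn; ring.
by rewrite /counit dN /=; ring.
Qed.

Lemma iter_diff2_shift c p k m :
  iter p diff2 (fun j => c (j + k)%N) m = iter p diff2 c (m + k)%N.
Proof. by elim: p m => //= p IH m; rewrite /diff2 !IH. Qed.

Lemma eq_iter_diff2 c c' p m : c =1 c' -> iter p diff2 c m = iter p diff2 c' m.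
Proof. by move=> cc'; elim: p m => //= p IH m; rewrite /diff2 !IH. Qed.

Lemma p_minus_cons x y a :
  p_minus (x :: y :: a) = ((1 < x) + p_minus (y :: a))%N.
Proof. by []. Qed.

(** A counted part is at least 2 and the final part at least 1; this keeps later natural
    subtractions from truncating. *)
Lemma p_minus_double_lt a : is_comp a -> (0 < size a)%N ->
  (2 * p_minus a < sumn a)%N.
Proof.
elim: a => // x [|y a] IH; first by rewrite /p_minus /= addn0; lia.
rewrite p_minus_cons => /andP[x0 /IH /(_ isT)].
rewrite -[sumn (x :: _)]/(x + sumn (y :: a))%N.
by move: (p_minus _) (sumn _) => p m; case: ltnP x0 => /=; lia.
Qed.

(** The total t^n (1 - t^-2)^p in the form (-1)^p (1 - t^2)^p t^(n-2p). *)
Lemma onF_phi c a : is_comp a -> (0 < size a)%N ->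
  onF (phi c) a =
    (-1) ^+ p_minus a * iter (p_minus a) diff2 c (sumn a - 2 * p_minus a)%N.
Proof.
elim: a c => // x [|y a] IH c.
  by move=> /andP[x0 _] _; rewrite onF_phi1 // /p_minus /= addn0 subn0 mul1r.
move=> xya _; have /andP[x0 hc] : (0 < x)%N && is_comp (y :: a) by [].
clear xya; have lt2p := p_minus_double_lt hc isT.
have /andP[y0 _] : is_comp (y :: a) by [].
rewrite p_minus_cons [sumn (x :: _)]/= -[(y + sumn a)%N]/(sumn (y :: a)).
set p := p_minus (y :: a) in lt2p IH *; set n := sumn (y :: a) in lt2p IH *.
case: x x0 => // [[|x]] _.
  rewrite onF_phi_one IH // add0n; congr (_ * _).
  rewrite (_ : 1 + n - _ = n - 2 * p + 1)%N; last by lia.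
  rewrite -iter_diff2_shift; apply: eq_iter_diff2 => j.
  by rewrite addn1.
rewrite onF_phi_cons // IH //= exprS mulN1r mulNr; congr (- (_ * _)).
rewrite (_ : x.+2 + n - _ = n - 2 * p + x)%N; last by lia.
by rewrite -iterS -iter_diff2_shift iterSr.
Qed.

(** * The coefficient series of the two parts *)

Definition catc p q : K := (superC p q)%:R / 2%:R ^+ (2 * (p + q)).

(* The coefficients of [(1 - t^2)^(-1/2)], [(1 + t) (1 - t^2)^(-1/2)] and
   [(1 - t^2)^(1/2)]. *)
Definition ecoef (j : nat) : K := if odd j then 0 else catc 0 j./2.
Definition mcoef (j : nat) : K := catc 0 j./2.
Definition pcoef (j : nat) : K := ecoef j - delay (delay ecoef) j.

(* The functional [(1 + E) sum_j pcoef_j U^j]. *)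
Definition plus_part (a : seq nat) : K :=
  if a is x :: a' then
    if odd x then phi (fun j => pcoef j.+1) a' else counit K a'
  else 1.

Section Char2.
Hypothesis char2 : 2%:R != 0 :> K.

(** [superC_rec] divided by 4^(p+q+1). *)
Lemma catc_diff p q : catc p q - catc p q.+1 = catc p.+1 q.
Proof.
rewrite /catc addSn addnS mulnSr exprD; set u := 2%:R ^+ _.
have u0 : u != 0 by rewrite expf_neq0.
have /(congr1 (fun k => k%:R : K)) := superC_rec p q.
rewrite natrD natrM => /(canRL (addrK _)) ->.
by field; rewrite u0 andbT (natrM _ 2 2) mulf_neq0.
Qed.

Lemma iter_diff2_mcoef p m : iter p diff2 mcoef m = catc p m./2.
Proof. by elim: p m => //= p IH m; rewrite /diff2 !IH catc_diff. Qed.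

Lemma iter_diff2_ecoef p m :
  iter p diff2 ecoef m = if odd m then 0 else catc p m./2.
Proof.
elim: p m => //= p IH m; rewrite /diff2 !IH /= negbK.
by case: ifP => _; rewrite ?subrr // catc_diff.
Qed.

(** The square of (1 - t)^(-1/2) is 1/(1 - t). *)
Lemma sum_catc0 m : \sum_(j < m.+1) catc 0 j * catc 0 (m - j) = 1.
Proof.
rewrite (eq_bigr (fun j : 'I_m.+1 =>
  (superC 0 j * superC 0 (m - j))%:R / 2%:R ^+ (2 * m))).
  rewrite -mulr_suml -natr_sum sum_superC0_mul.
  by rewrite -[4%N]/(2 ^ 2)%N -expnM natrX divff // expf_neq0.
move=> j _; rewrite /catc !add0n natrM.
by rewrite mulrACA -invfM -exprD -mulnDr subnKC // -ltnS.
Qed.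

(** (1 + t)/(1 - t^2) = 1/(1 - t). *)
Lemma cauchy_ecoef_mcoef m : cauchy ecoef mcoef m = 1.
Proof.
rewrite -(sum_catc0 m./2).
rewrite -(sum_even_half (fun j => catc 0 j * catc 0 (m./2 - j))).
apply: eq_bigr => i _; rewrite /ecoef /mcoef.
case: ifP => [_|oi]; first by rewrite mul0r.
by congr (_ * catc 0 _); have := ltn_ord i; lia.
Qed.

Lemma mcoef0 : mcoef 0 = 1.
Proof. by rewrite /mcoef /catc superC00 divr1. Qed.

Lemma pcoef0 : pcoef 0 = 1.
Proof. by rewrite /pcoef /ecoef /= subr0; apply: mcoef0. Qed.

Lemma sign_mcoef j : (-1) ^+ j * mcoef j = ecoef j - delay ecoef j.
Proof.
case: j => [|j]; first by rewrite mul1r subr0.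
rewrite /= /ecoef /mcoef -signr_odd /= uphalf_half.
by case: (odd j) => /=; rewrite ?add0n ?add1n ?expr0 ?expr1; ring.
Qed.

(** The left factor is (1 - t) times the series [ecoef], and (1 - t)/(1 - t) = 1. *)
Lemma cauchy_sign_mcoef m :
  cauchy (fun j => (-1) ^+ j * mcoef j) mcoef m = (m == 0%N)%:R.
Proof.
transitivity (cauchy (fun j => ecoef j - delay ecoef j) mcoef m).
  by apply: eq_bigr => i _; rewrite sign_mcoef.
rewrite cauchyBl cauchy_delay cauchy_ecoef_mcoef.
by case: m => [|m] /=; rewrite ?cauchy_ecoef_mcoef ?subr0 ?subrr.
Qed.

(** (1 - t^2)/(1 - t) = 1 + t. *)
Lemma cauchy_pcoef_mcoef m : cauchy pcoef mcoef m = (m <= 1)%N%:R.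
Proof.
rewrite cauchyBl cauchy_delay cauchy_ecoef_mcoef.
case: m => [|[|m]] /=; rewrite ?cauchy_delay /= ?subr0 //.
by rewrite cauchy_ecoef_mcoef subrr.
Qed.

(** * The two parts of [zeta] *)

Lemma minus_part_odd a : conv (fbar (phi mcoef)) (phi mcoef) a = counit K a.
Proof.
rewrite (eq_convl _ _ (fbar_phi _)) conv_phi -phi_delta.
exact: eq_phi cauchy_sign_mcoef.
Qed.

Lemma pcoef_odd j : odd j -> pcoef j = 0.
Proof.
rewrite /pcoef /ecoef; case: j => [|[|j]] //= oj; first by rewrite subrr.
by move: oj; rewrite negbK => ->; rewrite subrr.
Qed.

(** Since (1 + E) U = O, an odd first letter is followed by [pcoef] divided by t, an odd series; the
    two signs cancel. *)
Lemma plus_part_even a : fbar plus_part a = plus_part a.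
Proof.
case: a => [|x a]; first by rewrite /fbar mul1r.
rewrite /fbar /= exprD -(signr_odd K x); case: ifP => _.
  rewrite expr1 -mulrA -/(fbar _ a) fbar_phi.
  rewrite [RHS](@phi_comb (-1) 0 (fun j => (-1) ^+ j * pcoef j.+1) (fun=> 0)).
    by ring.
  move=> j /=; rewrite -signr_odd; case: (boolP (odd j)) => oj.
    by rewrite expr1; ring.
  by rewrite pcoef_odd //=; ring.
by rewrite expr0 mul1r /counit; case: a => [|y a]; rewrite ?mulr1 ?mulr0.
Qed.

(** By [cauchy_pcoef_mcoef] the product is (1 + E)(1 + U) = 1 + E + O. *)
Lemma zeta_factor a : conv plus_part (phi mcoef) a = zeta K a.
Proof.
case: a => [|x a].
  by rewrite /conv big_ord1 /= mcoef0 mul1r.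
have zetaE : zeta K (x :: a) = counit K a by rewrite /zeta /counit; case: a.
rewrite conv_cons zetaE mul1r [phi _ (x :: a)]/=.
case: (boolP (odd x)) => ox.
  rewrite (@eq_convl _ (phi (fun j => pcoef j.+1))) => [|b]; last first.
    by rewrite /= ox.
  rewrite conv_phi -phi_delta; symmetry.
  rewrite (@phi_comb 1 1 (fun j => mcoef j.+1)
    (cauchy (fun j => pcoef j.+1) mcoef)) ?mul1r // => j.
  have := cauchy_pcoef_mcoef j.+1; rewrite cauchyS pcoef0 !mul1r => ->.
  by rewrite ltnS leqn0.
rewrite (@eq_convl _ (counit K)) => [|b]; last by rewrite /= (negbTE ox).
by rewrite conv_counitl mcoef0; ring.
Qed.

(** * The even part on the fundamental basis *)

(** A first part 2 with something after it contributes 0, and raising the first part by 2 keeps its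
    parity. *)
Lemma sum_comps_posSS_plus_part n b :
  \sum_(g <- comps_pos n.+2) plus_part (g ++ b) =
    \sum_(g <- comps_pos n.+1) phi (fun j => pcoef j.+1) (g ++ b)
      + \sum_(g <- comps_pos n) plus_part (g ++ b).
Proof.
rewrite sum_comps_posS sum_comps_posS_succ; congr (_ + _).
rewrite -big_split !big_seq; apply: eq_bigr => -[|y g] /comps_pos_nilF //= _.
by rewrite /counit add0r negbK.
Qed.

(** Telescoping: t^(n+3) - t^(n+1) from a first part 1, plus t^(n+1) by induction. A nonfinal first
    part x thus contributes t^x alone, which is why [p_plus] does not test it. *)
Lemma sum_comps_pos_plus_part n y b :
  \sum_(g <- comps_pos n) plus_part (g ++ y :: b) =
    phi (fun j => pcoef (j + n.+1)%N) (y :: b).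
Proof.
elim/ltn_ind: n => -[|[|n]] IH.
- by rewrite big_seq1; apply: eq_phi => j; rewrite addn1.
- rewrite sum_comps_posS !big_seq1 [X in _ + X]/= addr0.
  transitivity (phi (fun j => pcoef j.+2) (y :: b)); first by [].
  by apply: eq_phi => j; rewrite addn2.
rewrite sum_comps_posSS_plus_part IH // sum_comps_pos_phi.
have shiftE k : (fun j => pcoef (j + k).+1) =1 (fun j => pcoef (j + k.+1)%N).
  by move=> j; rewrite addnS.
rewrite !(eq_phi _ (shiftE _)) /counit mul0r; ring.
Qed.

(** With nothing following, the recursion sums [pcoef] in steps of two, which divides by 1 - t^2. *)
Lemma sum_comps_pos_plus_part_nil n :
  \sum_(g <- comps_pos n) plus_part (g ++ [::]) = ecoef n.+1.
Proof.
elim/ltn_ind: n => -[|[|n]] IH.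
- by rewrite big_seq1 /= pcoef_odd.
- by rewrite sum_comps_posS !big_seq1 /= /pcoef /= -[ecoef 0]/(mcoef 0) mcoef0 subrK.
rewrite sum_comps_posSS_plus_part IH // sum_comps_pos_phi /= /counit eqxx !add0n.
by rewrite /pcoef /=; ring.
Qed.

Lemma onF_plus_part_cons x y a : (0 < x)%N -> (0 < y)%N ->
  onF plus_part (x :: y :: a) = onF (phi (fun j => pcoef (j + x)%N)) (y :: a).
Proof.
case: x => // x _ y0; rewrite onF_cons /onF !big_seq.
apply: eq_bigr => b /(refinements_nilF y0).
by case: b => // z b _; apply: sum_comps_pos_plus_part.
Qed.

(** As [pcoef] is (1 - t^2) times [ecoef], one more difference appears: the leading 1 in
    [p_plus]. *)
Lemma iter_diff2_pcoef p m :
  iter p diff2 pcoef m.+2 = - iter p.+1 diff2 ecoef m.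
Proof.
elim: p m => [|p IH] m /=; first by rewrite /pcoef /diff2 /=; ring.
by rewrite [LHS]/diff2 !IH /= /diff2; ring.
Qed.

Lemma onF_minus_part a : is_comp a ->
  onF (phi mcoef) a = (-1) ^+ p_minus a / 2%:R ^+ (2 * (sumn a)./2)
    * (superC (p_minus a) ((sumn a)./2 - p_minus a))%:R.
Proof.
case: a => [_|x a ha].
  by rewrite /onF big_seq1 /= mcoef0 superC00 divr1 mulr1.
have lt2p := p_minus_double_lt ha isT.
rewrite onF_phi // iter_diff2_mcoef /catc.
move: (p_minus _) (sumn _) lt2p => p n lt2p.
have -> : ((n - 2 * p)./2 = n./2 - p)%N by lia.
by rewrite subnKC; [ring | lia].
Qed.

Lemma onF_plus_part a : is_comp a ->
  onF plus_part a =
    if ~~ odd (sumn a) then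
      (-1) ^+ p_plus a / 2%:R ^+ sumn a
        * (superC (p_plus a) ((sumn a)./2 - p_plus a))%:R
    else 0.
Proof.
have even_half n : ~~ odd n -> (2 * n./2 = n)%N.
  by move=> en; rewrite mul2n even_halfK.
case: a => [_|x [|y a]].
- by rewrite /onF big_seq1 /= superC00 divr1 mulr1.
- case: x => // x _; rewrite onF_cons big_seq1 sum_comps_pos_plus_part_nil.
  rewrite /ecoef /p_plus [sumn _]/= addn0 if_neg subn0; case: ifP => // ox.
  by rewrite /catc add0n even_half ?ox //; ring.
move=> xya; have /andP[x0 ya] : (0 < x)%N && is_comp (y :: a) by [].
have /andP[y0 _] : (0 < y)%N && is_comp a by [].
rewrite onF_plus_part_cons // onF_phi // iter_diff2_shift.
have lt2p := p_minus_double_lt ya isT.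
have -> : p_plus [:: x, y & a] = (p_minus (y :: a)).+1 by rewrite /p_plus /= drop0.
rewrite -[sumn (x :: _)]/(x + sumn (y :: a))%N.
move: (p_minus _) (sumn (y :: a)) lt2p => p m lt2p.
(* 2p < m and x > 0 make the index at least 2, as [iter_diff2_pcoef] requires. *)
have -> : (m - 2 * p + x = (x + m - 2 * p.+1).+2)%N by lia.
rewrite iter_diff2_pcoef iter_diff2_ecoef.
have -> : odd (x + m - 2 * p.+1) = odd (x + m) by lia.
rewrite if_neg; case: ifP => oxm; first by rewrite oppr0 mulr0.
have -> : ((x + m - 2 * p.+1)./2 = (x + m)./2 - p.+1)%N by lia.
rewrite /catc subnKC; last by lia.
by rewrite even_half ?oxm // exprS; ring.
Qed.

End Char2.
End Functionals.

Theorem theorem5p1 (K : fieldType) (char2 : (2%:R : K) != 0)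
  (zp zm : functional K)
  (hp : is_character zp) (hpe : is_even zp)
  (hm : is_character zm) (hmo : is_odd zm)
  (hfac : forall a, is_comp a -> zeta K a = conv zp zm a)
  (n : nat) (a : seq nat) (ha : is_comp a) (hn : sumn a = n) :
  onF zm a = (-1) ^+ (p_minus a) / 2%:R ^+ (2 * n./2)
               * (superC (p_minus a) (n./2 - p_minus a))%:R
  /\
  onF zp a = (if ~~ odd n then
                (-1) ^+ (p_plus a) / 2%:R ^+ n
                  * (superC (p_plus a) (n./2 - p_plus a))%:R
              else 0).
Proof.
(* Both pairs factor [zeta], so they agree on compositions, and [onF] evaluates only there. *)
have uniq b : is_comp b -> zp b = plus_part K b /\ zm b = phi (mcoef K) b.
  move: b; apply: (even_odd_factor_uniq char2 hp.1 hm.1 _ _ hpe) => //.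
  - exact: mcoef0.
  - by move=> c _; apply: plus_part_even.
  - by move=> c /hmo[].
  - by move=> c _; apply: minus_part_odd.
  by move=> c hc; rewrite -hfac // zeta_factor.
have onF_eq (f g : functional K) : (forall b, is_comp b -> f b = g b) ->
    onF f a = onF g a.
  move=> fg; rewrite /onF !big_seq; apply: eq_bigr => b b_a; apply: fg.
  exact: is_comp_refinements b_a.
rewrite -hn (onF_eq zm _ (fun b hb => (uniq b hb).2)).
rewrite (onF_eq zp _ (fun b hb => (uniq b hb).1)).
by rewrite onF_minus_part // onF_plus_part.
Qed.
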